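(* Let $C$ be any call pricing function, let $T>0$ be a fixed expiry, and let $I$ be the implied volatility associated with $C$; write $C(K)=C(T,K)$ and $I(K)=I(T,K)$. Then, as $K\to\infty$, $$I(K)=\frac{\sqrt2}{\sqrt T}\left[\sqrt{\log K+\log\frac1{C(K)}}-\sqrt{\log\frac1{C(K)}}\right]+O\left(\left(\log\frac1{C(K)}\right)^{-\frac12}\log\log\frac1{C(K)}\right).$$
   Context: Fix $r\ge 0$ (interest rate) and $x_0>0$. A stock price process is a positive adapted process $X$ on a filtered probability space $(\Omega,\mathcal F,\mathcal F_t,\mathbb P^* )$ such that $X_0=x_0$ $\mathbb P^*$-a.s., $\mathbb E^*[X_t]<\infty$ for all $t\ge0$, $X_t$ is an unbounded random variable (i.e. $\mathbb P^*[X_t>K]>0$ for all $K$) for every $t>0$, and $e^{-rt}X_t$ is an $(\mathcal F_t,\mathbb P^* )$-martingale. The associated call pricing function is $C(T,K)=e^{-rT}\mathbb E^*[(X_T-K)^+]$, $T,K\ge0$. For each $T>0$ one has $C(T,K)>0$ for all $K>0$ and $C(T,K)\to0$ as $K\to\infty$. Black-Scholes function: $C_{BS}(T,K,\sigma)=x_0N(d_1)-Ke^{-rT}N(d_2)$, where $N$ is the standard normal distribution function, $d_1=\frac{\log x_0-\log K+(r+\sigma^2/2)T}{\sigma\sqrt T}$, $d_2=d_1-\sigma\sqrt T$ for $\sigma>0$, and $C_{BS}(T,K,0)=(x_0-Ke^{-rT})^+$. The implied volatility $I(T,K)$, $T,K>0$, is the unique number $\sigma\ge0$ with $C_{BS}(T,K,\sigma)=C(T,K)$.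 $\varphi_1(K)=\varphi_2(K)+O(\rho(K))$ as $K\to\infty$ means $|\varphi_1(K)-\varphi_2(K)|\le\alpha\rho(K)$ for some $\alpha>0$ and all sufficiently large $K$. *)

(* Defs.v *)
From HB Require Import structures.
From mathcomp Require Import all_boot all_order all_algebra.
From mathcomp Require Import all_classical all_reals all_analysis.

Set Implicit Arguments.
Unset Strict Implicit.
Unset Printing Implicit Defensive.

Import Order.TTheory GRing.Theory Num.Theory.
Import numFieldNormedType.Exports.

Local Open Scope classical_set_scope.
Local Open Scope ring_scope.

(* Processes are functions of a time t : R; only times t >= 0 are constrained. *)

Section processes.
Context {d : measure_display} {Omega : measurableType d} {R : realType}.
Variable P : probability Omega R.

Definition filtration (F : R -> set (set Omega)) : Prop :=
  [/\ forall t, 0 <= t -> sigma_algebra setT (F t),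
      forall t, 0 <= t -> F t `<=` measurable &
      forall s t, 0 <= s -> s <= t -> F s `<=` F t].

Definition measurable_wrt (G : set (set Omega)) (Y : Omega -> R) : Prop :=
  forall B : set R, measurable B -> G (Y @^-1` B).

Definition adapted (F : R -> set (set Omega)) (M : R -> Omega -> R) : Prop :=
  forall t, 0 <= t -> measurable_wrt (F t) (M t).

(* Z is a version of the conditional expectation E[Y | G]. *)
Definition is_cond_expectation (G : set (set Omega)) (Y Z : Omega -> R) : Prop :=
  [/\ measurable_wrt G Z,
      P.-integrable setT (EFin \o Z) &
      forall A, G A ->
        (\int[P]_(w in A) (Z w)%:E = \int[P]_(w in A) (Y w)%:E)%E].

Definition martingale (F : R -> set (set Omega)) (M : R -> Omega -> R) : Prop :=
  [/\ adapted F M,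
      forall t, 0 <= t -> P.-integrable setT (EFin \o M t) &
      forall s t, 0 <= s -> s <= t -> is_cond_expectation (F s) (M t) (M s)].

Record stock_price_process (r x0 : R) (F : R -> set (set Omega))
    (X : R -> Omega -> R) : Prop := StockPriceProcess {
  stock_price_adapted : adapted F X;
  stock_price_positive : forall (t : R) (w : Omega), 0 <= t -> 0 < X t w;
  stock_price_init : {ae P, forall w, X 0 w = x0};
  stock_price_expectation : forall t : R, 0 <= t -> ('E_P[X t] < +oo)%E;
  stock_price_unbounded :
    forall t : R, 0 < t -> forall K : R, (0 < P [set w | (K < X t w)%R])%E;
  stock_price_martingale :
    martingale F (fun t w => expR (- (r * t)) * X t w) }.

Definition call_price (r : R) (X : R -> Omega -> R) (T K : R) : R :=
  expR (- (r * T)) * fine 'E_P[fun w => Num.max (X T w - K) 0].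

End processes.

Section implied_volatility.
Context {R : realType}.

Definition is_call_pricing_function (r x0 : R) (C : R -> R -> R) : Prop :=
  exists (d : measure_display) (Omega : measurableType d)
    (P : probability Omega R) (F : R -> set (set Omega)) (X : R -> Omega -> R),
    [/\ filtration F, stock_price_process P r x0 F X &
        forall T K, 0 <= T -> 0 <= K -> C T K = call_price P r X T K].

Definition std_normal_cdf (x : R) : R := fine (normal_prob 0 1 `]-oo, x]).

Definition bs_d1 (r x0 T K sigma : R) : R :=
  (ln x0 - ln K + (r + sigma ^+ 2 / 2) * T) / (sigma * Num.sqrt T).

Definition bs_d2 (r x0 T K sigma : R) : R :=
  bs_d1 r x0 T K sigma - sigma * Num.sqrt T.

Definition black_scholes (r x0 T K sigma : R) : R :=
  if sigma == 0 then Num.max (x0 - K * expR (- (r * T))) 0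
  else x0 * std_normal_cdf (bs_d1 r x0 T K sigma)
       - K * expR (- (r * T)) * std_normal_cdf (bs_d2 r x0 T K sigma).

(* For T, K > 0 and a call pricing function C the set below is a singleton, so
   [get] is the definite description of its unique element. *)
Definition implied_volatility (r x0 : R) (C : R -> R -> R) (T K : R) : R :=
  get [set sigma : R | 0 <= sigma /\ black_scholes r x0 T K sigma = C T K].

(* phi1(K) = phi2(K) + O(rho(K)) as K -> +oo.  The bound is on rho itself, not
   on its absolute value as in the Landau notations of [landau]. *)
Definition eq_bigO_pinfty (phi1 phi2 rho : R -> R) : Prop :=
  exists2 alpha : R, 0 < alpha &
    \forall K \near +oo, `|phi1 K - phi2 K| <= alpha * rho K.

End implied_volatility.

(* Main.v *)
(* With v = I sqrt T, y = -d1 and k = ln (K e^(-rT) / x0) one has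
   k = v y + v^2 / 2, i.e. v = sqrt (y^2 + 2 k) - y, and
     C / x0 = N(-y) - e^k N(-y - v)
            = \int_y^oo (1 - e^(-v (u - y))) phi(u) du.
   This integral is at most e^(-y^2/2), and restricting it to
   [y + 1/y, y + 2/y] bounds it below by a multiple of y^-3 e^(-y^2/2), because
   v >= 1/y as soon as k >= 3/2.  Hence y^2 / 2 = L + O(ln L) for
   L = ln (1 / C), so that replacing y by sqrt (2 L) and k by ln K in the
   formula for v costs only O(ln L / sqrt L). *)

Require Import Defs.
From HB Require Import structures.
From mathcomp Require Import all_boot all_order all_algebra.
From mathcomp Require Import all_classical all_reals all_analysis.
From mathcomp Require Import measurable_realfun ring lra.

Set Implicit Arguments.
Unset Strict Implicit.
Unset Printing Implicit Defensive.

Import Order.TTheory GRing.Theory Num.Theory.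
Import numFieldNormedType.Exports.

Local Open Scope classical_set_scope.
Local Open Scope ring_scope.

(** * Standard normal distribution function: derivative, limit and tail bound *)

Section normal_cdf.
Context {R : realType}.
Implicit Types x y u v k : R.
Local Notation N := (@std_normal_cdf R).

Lemma std_normal_pdfE x :
  normal_pdf 0 1 x = normal_peak 1 * expR (- x ^+ 2 / 2) :> R.
Proof.
by rewrite normal_pdfE ?oner_eq0// /normal_fun subr0 expr1n.
Qed.

Lemma std_normal_cdf_ge0 x : 0 <= N x.
Proof. by rewrite fine_ge0. Qed.

Lemma is_derive_std_normal_cdf x : is_derive x 1 N (normal_pdf 0 1 x).
Proof.
(* The half-line ends at [x + 1] so that [x] is interior to it. *)
have intf : (@lebesgue_measure R).-integrable `]-oo, (x + 1)]
    (EFin \o normal_pdf 0 1).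
  by apply: integrableS (integrable_normal_pdf 0 1).
have xx1 : x < x + 1 by rewrite ltrDl.
have [] := continuous_FTC1 xx1 intf (ltNyr _)
  (@continuous_normal_pdf R 0 1 (oner_neq0 _) x).
move=> dF FE.
split; first exact: dF.
by rewrite -derive1E.
Qed.

Lemma cvg_std_normal_cdfNy : N u @[u --> -oo] --> 0.
Proof.
(* [N] is the cdf of the identity, seen as a random variable under the normal law. *)
pose idR : measurableTypeR R -> R := idfun.
have midR : measurable_fun setT idR by exact: measurable_id.
pose X : {RV (normal_prob 0 1 : probability (measurableTypeR R) R) >-> R} :=
  mfun_Sub (mem_set midR).
exact: (fine_cvg (@cvg_cdfNy0 _ _ _ _ X)).
Qed.

Lemma normal_peak1_le1 : normal_peak 1 <= 1 :> R.
Proof.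
have p1 : 1 <= 1 ^+ 2 * pi *+ 2 :> R.
  by have := pi_ge2 R; rewrite expr1n mul1r mulr2n; lra.
rewrite invf_le1; first by rewrite -[leLHS]sqrtr1 ler_wsqrtr.
by rewrite sqrtr_gt0 (lt_le_trans ltr01).
Qed.

(** By the mean value theorem [h] stays below [h x] to the right of [x], hence so does its limit.
    Tails are compared in this way, through the sign of a derivative. *)
Lemma derive_le0_cvg0_ge0 (h dh : R -> R) x :
  (forall u, is_derive u 1 h (dh u)) -> (forall u, x <= u -> dh u <= 0) ->
  h u @[u --> +oo] --> 0 -> 0 <= h x.
Proof.
move=> h' dh0 h0; rewrite -(cvg_lim _ h0)//; apply: limr_le.
  by apply/cvg_ex; exists 0.
near=> u; have xu : x < u by near: u; apply: nbhs_pinfty_gt; rewrite num_real.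
have ch : {within `[x, u], continuous h}.
  apply: continuous_subspaceT => z.
  by apply/differentiable_continuous/derivable1_diffP.
have [z /[!in_itv]/= /andP[xz _] hE] := MVT xu (fun z _ => h' z) ch.
by rewrite -subr_le0 hE mulr_le0_ge0 ?dh0 ?subr_ge0// ltW.
Unshelve. all: by end_near. Qed.

Lemma cvg_std_normal_cdf_oppD v : N (- u - v) @[u --> +oo] --> 0.
Proof.
apply: (cvg_comp _ _ _ cvg_std_normal_cdfNy).
apply/cvgrNyPle => A; near=> u.
suff : - A - v <= u by lra.
by near: u; apply: nbhs_pinfty_ge; rewrite num_real.
Unshelve. all: by end_near. Qed.

Lemma is_derive_std_normal_cdf_oppD v u :
  is_derive u 1 (fun u => N (- u - v)) (- normal_pdf 0 1 (- u - v)).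
Proof.
have Dl : is_derive u 1 (fun u : R => - u - v) (-1).
  by apply: is_derive_eq; rewrite subr0.
have := @is_derive1_comp _ N (fun u => - u - v) u _ _
  (is_derive_std_normal_cdf _) Dl.
by rewrite mulrN1.
Qed.

(** The difference of the two sides tends to 0, and its derivative has the sign of
    [normal_peak 1 - u], which is nonpositive for u >= 1 because the peak is at most 1. *)
Lemma std_normal_cdf_le y : 1 <= y -> N (- y) <= expR (- y ^+ 2 / 2).
Proof.
move=> y1; rewrite -subr_ge0.
pose h u := expR (- u ^+ 2 / 2) - N (- u - 0).
rewrite -[X in N X]subr0 -/(h y).
apply: (@derive_le0_cvg0_ge0 h
  (fun u => (normal_peak 1 - u) * expR (- u ^+ 2 / 2))).
- move=> u.
  have := is_derive_std_normal_cdf_oppD 0 u.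
  rewrite std_normal_pdfE => ?.
  apply: is_derive_eq.
  rewrite subr0 sqrrN /GRing.scale/=; lra.
- move=> u yu; rewrite mulr_le0_ge0 ?expR_ge0//.
  by have := normal_peak1_le1; lra.
- rewrite -[X in _ --> X]subr0.
  apply: cvgB; last exact: cvg_std_normal_cdf_oppD.
  (* The bound e^(-u^2 / 2) <= e^(2 - u) follows from (u - 1)^2 >= 0. *)
  apply: (@squeeze_cvgr _ _ _ _ (cst 0) (fun u => expR (- u) * expR 2)).
  + near=> u; rewrite expR_ge0/= -expRD ler_expR.
    have : 0 <= (u - 1) ^+ 2 by rewrite sqr_ge0.
    rewrite !expr2; lra.
  + exact: cvg_cst.
  + by rewrite -[X in _ --> X](mul0r (expR 2)); apply: cvgMl; exact: cvgr_expR.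
Unshelve. all: by end_near. Qed.

End normal_cdf.

(** * The price in normalized variables, bounded on both sides *)

Section normalized_call.
Context {R : realType}.
Implicit Types y u v a b : R.
Local Notation N := (@std_normal_cdf R).
Local Notation phi := (@normal_pdf R 0 1).

(* C_BS / x0 in the variables y = -d1 and v = sigma sqrt T. *)
Definition normalized_call y v : R :=
  N (- y) - expR (v * y + v ^+ 2 / 2) * N (- y - v).

Lemma std_normal_pdfN u : phi (- u) = phi u.
Proof. by rewrite !std_normal_pdfE sqrrN. Qed.

Lemma normalized_call_le y v : 1 <= y ->
  normalized_call y v <= expR (- y ^+ 2 / 2).
Proof.
move=> y1; apply: le_trans (std_normal_cdf_le y1).
by rewrite gerBl mulr_ge0 ?expR_ge0 ?std_normal_cdf_ge0.
Qed.

(* As a function h of the lower endpoint u of the integral in the header, the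
   normalized price is decreasing on [y, oo) with limit 0, so
   h y >= h a - h b. *)
Lemma normalized_call_ge y v a b : 0 < v -> 0 <= a -> y <= a -> a < b ->
  (b - a) * (1 - expR (- v * (a - y))) * phi b <= normalized_call y v.
Proof.
move=> v0 a0 ya ab.
pose k := v * y + v ^+ 2 / 2.
pose h := fun u => N (- u - 0) - expR k * N (- u - v).
pose dh u := - (1 - expR (- v * (u - y))) * phi u.
have h' u : is_derive u 1 h (dh u).
  rewrite /h.
  have ? := is_derive_std_normal_cdf_oppD 0 u.
  have ? := is_derive_std_normal_cdf_oppD v u.
  apply: is_derive_eq; rewrite /GRing.scale/= subr0 std_normal_pdfN /dh.
  (* Completing the square: (u + v)^2 / 2 = u^2 / 2 + v (u - y) + k. *)
  suff -> : phi (- u - v) = expR (- k) * expR (- v * (u - y)) * phi u.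
    by rewrite expRN; field; rewrite gt_eqF ?expR_gt0.
  rewrite !std_normal_pdfE mulrCA -!expRD; congr (_ * expR _).
  by rewrite /k; field.
have dh0 u : y <= u -> dh u <= 0.
  move=> yu; rewrite /dh mulNr oppr_le0 mulr_ge0 ?normal_pdf_ge0// subr_ge0.
  by rewrite -expR0 ler_expR mulNr oppr_le0 mulr_ge0 ?subr_ge0// ltW.
have ch s t : {within `[s, t], continuous h}.
  apply: continuous_subspaceT => z.
  by apply/differentiable_continuous/derivable1_diffP.
have hy : h y = normalized_call y v by rewrite /h subr0.
have ha : h a <= h y.
  have [c /[!in_itv]/= /andP[yc _] hE] :=
    MVT_segment ya (fun z _ => h' z) (ch _ _).
  by rewrite -subr_le0 hE mulr_le0_ge0 ?dh0 ?subr_ge0.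
have hb : 0 <= h b.
  apply: (derive_le0_cvg0_ge0 h'); first by move=> u bu; apply: dh0; lra.
  rewrite (_ : 0 = 0 - expR k * 0); last by rewrite mulr0 subr0.
  apply: cvgB; first exact: cvg_std_normal_cdf_oppD.
  by apply: cvgMr; exact: cvg_std_normal_cdf_oppD.
have [c /[!in_itv]/= /andP[ac cb] hE] := MVT ab (fun z _ => h' z) (ch _ _).
rewrite -hy; apply: le_trans ha.
(* At [c] the factor 1 - e^(-v (u - y)) is at least its value at [a], and [phi] is at least its
   value at [b], since 0 <= a < c < b. *)
suff : (b - a) * (1 - expR (- v * (a - y))) * phi b <=
    (1 - expR (- v * (c - y))) * phi c * (b - a).
  by rewrite /dh in hE; lra.
rewrite [leRHS]mulrC -mulrA ler_wpM2l ?subr_ge0 ?(ltW ab)//.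
have va0 : expR (- v * (a - y)) <= 1.
  by rewrite -expR0 ler_expR mulNr oppr_le0 mulr_ge0 ?subr_ge0// ltW.
apply: ler_pM; rewrite ?subr_ge0 ?normal_pdf_ge0//.
  by rewrite lerD2l lerN2 ler_expR !mulNr lerN2 ler_wpM2l ?(ltW v0)//; lra.
rewrite !std_normal_pdfE ler_wpM2l ?normal_peak_ge0// ler_expR !mulNr lerN2.
by rewrite ler_wpM2r ?invr_ge0// lerXn2r ?nnegrE; lra.
Qed.

End normalized_call.

(** * Explicit lower bounds on the price, and solvability in y *)

Section call_bounds.
Context {R : realType}.
Implicit Types y v k c : R.

(** The factor e^(-4) bounds the loss in the density from y >= 1 to y + 2/y, as (y + 2/y)^2 / 2 =
    y^2 / 2 + 2 + 2/y^2; the factor 1/2 comes from 1 - e^(-v/y) >= 1 / (2 y^2). *)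
Definition call_const : R := normal_peak 1 * expR (- 4) / 2.

Lemma call_const_gt0 : 0 < call_const.
Proof. by rewrite divr_gt0// mulr_gt0 ?expR_gt0 ?normal_peak_gt0. Qed.

(** Used to exclude y < 1 when the price is small. Here k >= 3/2 forces v > 1, so on [2, 3] the
    factor 1 - e^(-v (2 - y)) is at least 1/2; the density at 3 has exponent -9/2 = -4 - 1/2. *)
Lemma normalized_call_ge_lt1 y v : y < 1 -> 3 / 2 <= v * y + v ^+ 2 / 2 ->
  0 < v -> call_const * expR (- (1 / 2)) <= normalized_call y v.
Proof.
move=> y1 hk v0.
have v1 : 1 < v.
  rewrite ltNge; apply/negP => v1.
  have : v * y < v * 1 by rewrite ltr_pM2l.
  have : v ^+ 2 <= 1 by rewrite expr_le1// ltW.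
  lra.
have y2 : y <= 2 by lra.
have lt23 : 2 < 3 :> R by lra.
apply: le_trans (normalized_call_ge v0 (ler0n _ 2) y2 lt23).
rewrite std_normal_pdfE (_ : 3 - 2 = 1); last by ring.
have -> : - 3 ^+ 2 / 2 = - 4 + - (1 / 2) :> R by field.
rewrite expRD /call_const.
have eh : expR (- v * (2 - y)) <= 1 / 2.
  rewrite mulNr expRN mul1r lef_pV2 ?posrE ?expR_gt0//.
  apply: le_trans (expR_ge1Dx _).
  suff : 1 * 1 <= v * (2 - y) by lra.
  by rewrite ler_pM; lra.
have p0 : 0 <= normal_peak 1 * expR (- 4) * expR (- (1 / 2)) :> R.
  by rewrite !mulr_ge0 ?expR_ge0 ?normal_peak_ge0.
have : normal_peak 1 * expR (- 4) * expR (- (1 / 2)) * (1 / 2) <=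
  normal_peak 1 * expR (- 4) * expR (- (1 / 2)) * (1 - expR (- v * (2 - y))).
  by rewrite ler_wpM2l//; lra.
lra.
Qed.

Lemma normalized_call_ge_ge1 y v : 1 <= y -> 3 / 2 <= v * y + v ^+ 2 / 2 ->
  0 < v -> call_const / y ^+ 3 * expR (- y ^+ 2 / 2) <= normalized_call y v.
Proof.
move=> y1 hk v0.
have y0 : 0 < y by lra.
(* Otherwise v <= v y < 1, and k < 3/2. *)
have vy : 1 <= v * y.
  rewrite leNgt; apply/negP => vy1.
  have vvy : v * 1 <= v * y by rewrite ler_pM2l.
  have : v ^+ 2 <= 1 by rewrite expr_le1//; lra.
  lra.
have iy0 : 0 < y^-1 by rewrite invr_gt0.
have ya : y <= y + y^-1 by lra.
have a0 : 0 <= y + y^-1 by lra.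
have ab : y + y^-1 < y + 2 * y^-1 by lra.
apply: le_trans (normalized_call_ge v0 a0 ya ab).
have -> : y + 2 * y^-1 - (y + y^-1) = y^-1 by ring.
have -> : y + y^-1 - y = y^-1 by ring.
have iy1 : y^-1 ^+ 2 <= 1 by rewrite expr_le1 ?invf_le1// ltW.
(* Uses e^s >= 1 + s with s = v/y >= 1/y^2, then (1 + t) (1 - t/2) >= 1 for t = 1/y^2 in [0, 1]. *)
have eh : y^-1 ^+ 2 / 2 <= 1 - expR (- v * y^-1).
  have : expR (- v * y^-1) <= (1 + y^-1 ^+ 2)^-1.
    have vi : y^-1 ^+ 2 <= v * y^-1.
      by rewrite expr2 ler_pM2r// -(ler_pM2r y0) mulVf ?gt_eqF.
    rewrite mulNr expRN lef_pV2 ?posrE ?expR_gt0//; last first.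
      by rewrite ltr_wpDr ?sqr_ge0.
    apply: le_trans (expR_ge1Dx _); lra.
  suff : (1 + y^-1 ^+ 2)^-1 <= 1 - y^-1 ^+ 2 / 2 by lra.
  set t := y^-1 ^+ 2 in iy1 *.
  have t0 : 0 <= t by rewrite sqr_ge0.
  rewrite -[leLHS]mul1r ler_pdivrMr; last by lra.
  nra.
have ph : normal_peak 1 * expR (- 4) * expR (- y ^+ 2 / 2) <=
    normal_pdf 0 1 (y + 2 * y^-1).
  rewrite std_normal_pdfE -mulrA ler_wpM2l ?normal_peak_ge0// -expRD ler_expR.
  have -> : - (y + 2 * y^-1) ^+ 2 / 2 = - y ^+ 2 / 2 - 2 - 2 * y^-1 ^+ 2.
    by field; rewrite gt_eqF.
  lra.
rewrite (_ : call_const / _ * _ = y^-1 * (y^-1 ^+ 2 / 2) *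
  (normal_peak 1 * expR (- 4) * expR (- y ^+ 2 / 2))); last first.
  by rewrite /call_const; field; rewrite gt_eqF.
have q0 : 0 <= y^-1 ^+ 2 / 2 by rewrite divr_ge0 ?sqr_ge0.
apply: ler_pM => //.
- by rewrite mulr_ge0// ltW.
- by rewrite !mulr_ge0 ?expR_ge0 ?normal_peak_ge0.
- by rewrite ler_wpM2l// ltW.
Qed.

(* The intermediate value theorem is applied in the variable y rather than v:
   the price is large at y = 1 and tends to 0 as y grows. *)
Lemma normalized_call_surj k c : 3 / 2 <= k -> 0 < c ->
  c <= call_const * expR (- (1 / 2)) ->
  exists y v, [/\ 0 < v, v * y + v ^+ 2 / 2 = k & normalized_call y v = c].
Proof.
move=> k32 c0 cle.
(* The positive root v of v y + v^2 / 2 = k. *)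
pose V y := Num.sqrt (y ^+ 2 + 2 * k) - y.
have Vk y : V y * y + V y ^+ 2 / 2 = k.
  have : Num.sqrt (y ^+ 2 + 2 * k) ^+ 2 = y ^+ 2 + 2 * k.
    by rewrite sqr_sqrtr// addr_ge0 ?sqr_ge0; lra.
  rewrite /V !expr2; lra.
have V0 y : 1 <= y -> 0 < V y.
  move=> y1; rewrite subr_gt0 -[ltLHS]ger0_norm -?sqrtr_sqr; last by lra.
  by rewrite ltr_sqrt; [lra|rewrite ltr_wpDl ?sqr_ge0//; lra].
pose G y := normalized_call y (V y).
have cG : continuous G.
  have cN : continuous (@std_normal_cdf R).
    move=> x; have ? := is_derive_std_normal_cdf x.
    by apply/differentiable_continuous/derivable1_diffP.
  have -> : G = (fun y => std_normal_cdf (- y) -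
      expR k * std_normal_cdf (- Num.sqrt (y ^+ 2 + 2 * k))).
    apply/funext => y; rewrite /G /normalized_call Vk.
    by rewrite (_ : - y - V y = - Num.sqrt (y ^+ 2 + 2 * k))// /V; ring.
  have cNN : continuous (fun y : R => std_normal_cdf (- y)).
    have oppc : continuous (fun y : R => - y) by exact: opp_continuous.
    by move=> y; apply: continuous_comp (oppc y) (cN _).
  move=> y; apply: (@cvgB _ R^o); first exact: cNN.
  apply: cvgM; first exact: cvg_cst.
  apply: (@continuous_comp _ _ _ (fun y => Num.sqrt (y ^+ 2 + 2 * k))
    (fun y => std_normal_cdf (- y))); last exact: cNN.
  apply: (@continuous_comp _ _ _ (fun y => y ^+ 2 + 2 * k) Num.sqrt).
    by apply: (@cvgD _ R^o); [exact: exprn_continuous|exact: cvg_cst].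
  exact: sqrt_continuous.
(* Chosen so that y2^2 / 2 >= y2 / 2 >= |ln c|, whence e^(-y2^2 / 2) <= c. *)
pose y2 : R := 1 + 2 * `|ln c|.
have y21 : 1 <= y2 by rewrite lerDl mulr_ge0.
have G1 : c <= G 1.
  apply: (le_trans cle).
  have := normalized_call_ge_ge1 (lexx 1) _ (V0 _ (lexx 1)).
  rewrite expr1n divr1 Vk => /(_ k32); apply: le_trans.
  by rewrite expr1n mulNr.
have G2 : G y2 <= c.
  apply: le_trans (normalized_call_le _ y21) _.
  rewrite -[leRHS]lnK ?posrE// ler_expR.
  have : 1 * y2 <= y2 ^+ 2 by rewrite expr2 ler_wpM2r//; lra.
  have := ler_norm (- ln c); rewrite normrN; rewrite /y2 ; lra.
have [y /[!in_itv]/= /andP[y1 _] Gy] : exists2 y, y \in `[1, y2] & G y = c.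
  apply: IVT => //; first exact: continuous_subspaceT.
  by rewrite ge_min G2 orbT le_max G1.
by exists y, (V y); split => //; exact: V0.
Qed.

End call_bounds.

(** * Expectation of the call payoff as a function of the strike *)

Section call_price.
Context {d : measure_display} {Omega : measurableType d} {R : realType}.
Variables (P : probability Omega R) (Y : Omega -> R).
Hypothesis mY : measurable_fun setT Y.
Hypothesis Y_ge0 : forall w, 0 <= Y w.
Hypothesis Y_fin : ('E_P[Y] < +oo)%E.

Local Notation payoff K := (fun w => Num.max (Y w - K) 0).

Let mpayoff (K : R) : measurable_fun setT (payoff K).
Proof. by apply: measurable_maxr => //; exact: measurable_funB. Qed.

Let payoff_ge0 (K : R) w : 0 <= payoff K w.
Proof. by rewrite le_max lexx orbT. Qed.

Let payoff_le (K : R) w : 0 <= K -> payoff K w <= Y w.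
Proof. by move=> K0; rewrite ge_max Y_ge0 andbT gerBl. Qed.

Lemma expectation_payoff_fin_num (K : R) : 0 <= K ->
  ('E_P[payoff K])%E \is a fin_num.
Proof.
move=> K0; rewrite ge0_fin_numE ?expectation_ge0//.
apply: le_lt_trans Y_fin; apply: expectation_le => //.
by apply: aeW => w; exact: payoff_le.
Qed.

(** The shift by 1 makes the payoff dominate the indicator of the event Y > K + 1. *)
Lemma expectation_payoff_gt0 (K : R) : 0 <= K ->
  (0 < P [set w | (K + 1 < Y w)%R])%E -> (0 < 'E_P[payoff K])%E.
Proof.
move=> K0; set A := [set w | _] => PA.
have mA : measurable A.
  rewrite (_ : A = setT `&` Y @^-1` `]K + 1, +oo[); first exact: mY.
  by rewrite setTI; apply/seteqP; split => w; rewrite /A/= in_itv/= andbT.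
apply: (lt_le_trans PA); rewrite -expectation_indic//.
apply: expectation_le => //.
apply: aeW => w; rewrite indicE; case: (boolP (w \in A)) => //= /set_mem Aw.
by rewrite le_max; apply/orP; left; move: Aw; rewrite /A/=; lra.
Qed.

(* The absolute value keeps the payoffs dominated by Y for every strike. *)
Lemma cvg_expectation_payoff : fine 'E_P[payoff `|K|]%E @[K --> +oo] --> 0.
Proof.
(* Along a sequence of strikes dominated convergence applies: each payoff vanishes once the strike
   passes [Y w]. *)
apply/cvg_pinftyP => u uy.
apply: (fine_cvg (a := 0%R)).
have iY : P.-integrable setT (EFin \o Y).
  apply/integrableP; split; first exact/measurable_EFinP.
  move: Y_fin; rewrite unlock.
  by under eq_integral do rewrite -(ger0_norm (Y_ge0 _)).
have := @dominated_convergence _ _ _ P setT measurableT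
  (fun n => EFin \o payoff `|u n|) (cst 0%E) (EFin \o Y) _ _ _ iY _.
case.
- by move=> n; exact/measurable_EFinP.
- exact: measurable_cst.
- apply: aeW => w _; apply: cvg_near_cst.
  have : \forall n \near \oo, Y w <= u n by move/cvgryPge: uy; apply.
  apply: filterS => n Yu /=; congr EFin; apply/max_idPr.
  by rewrite subr_le0 (le_trans Yu)// ler_norm.
- apply: aeW => w n _ /=; rewrite lee_fin ger0_norm//; exact: payoff_le.
- move=> _ _; rewrite integral0.
  by rewrite unlock.
Qed.

End call_price.

(** * Positivity and decay of the call price *)

Section call_pricing_function.
Context {R : realType}.
Variables (r x0 T : R) (C : R -> R -> R).
Hypotheses (hC : is_call_pricing_function r x0 C) (T0 : 0 < T).

Lemma call_pricing_gt0 (K : R) : 0 <= K -> 0 < C T K.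
Proof.
have [d [W [P [F [X [[_ Fm _] [adF X0 _ EX unbX _] CE]]]]]] := hC.
move=> K0; rewrite CE ?(ltW T0)// mulr_gt0 ?expR_gt0//.
have mX : measurable_fun setT (X T).
  by move=> _ B mB; rewrite setTI; apply: Fm (ltW T0) _ (adF _ (ltW T0) _ mB).
have Xge0 w : 0 <= X T w by rewrite ltW// X0// ltW.
have E0 : (0 < 'E_P[fun w => Num.max (X T w - K)%R 0%R])%E.
  exact: expectation_payoff_gt0 (unbX _ T0 _).
rewrite fine_gt0// E0 -ge0_fin_numE ?(ltW E0)//.
by rewrite expectation_payoff_fin_num// EX// ltW.
Qed.

Lemma cvg_call_pricing : C T K @[K --> +oo] --> 0.
Proof.
have [d [W [P [F [X [[_ Fm _] [adF X0 _ EX _ _] CE]]]]]] := hC.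
have mX : measurable_fun setT (X T).
  by move=> _ B mB; rewrite setTI; apply: Fm (ltW T0) _ (adF _ (ltW T0) _ mB).
have Xge0 w : 0 <= X T w by rewrite ltW// X0// ltW.
rewrite -(mulr0 (expR (- (r * T)))).
apply: (@cvg_trans _ ((expR (- (r * T)) *
  fine 'E_P[fun w => Num.max (X T w - `|K|)%R 0%R]%E) @[K --> +oo])).
  apply: near_eq_cvg; near=> K.
  have K0 : 0 <= K by near: K; apply: nbhs_pinfty_ge; rewrite num_real.
  by rewrite CE ?(ltW T0)// ger0_norm.
by apply: cvgMr; apply: cvg_expectation_payoff => //; rewrite EX// ltW.
Unshelve. all: by end_near. Qed.

End call_pricing_function.

(** * From the price to the implied volatility *)

Section implied_volatility_asymptotics.
Context {R : realType}.
Implicit Types r x T K sigma y v c : R.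

(** The relation between y and v says that y = -d1; then d2 = -y - v and e^k = K e^(-r T) / x0. *)
Lemma black_scholes_normalized r x0 T K sigma y v :
  0 < x0 -> 0 < T -> 0 < K -> 0 < sigma -> v = sigma * Num.sqrt T ->
  v * y + v ^+ 2 / 2 = ln K - r * T - ln x0 ->
  black_scholes r x0 T K sigma = x0 * normalized_call y v.
Proof.
move=> x00 T0 K0 s0 vE kE.
have sT : Num.sqrt T ^+ 2 = T by rewrite sqr_sqrtr// ltW.
have v0 : 0 < v by rewrite vE mulr_gt0// sqrtr_gt0.
have v2 : v ^+ 2 = sigma ^+ 2 * T by rewrite vE exprMn sT.
have d1E : bs_d1 r x0 T K sigma = - y.
  rewrite /bs_d1 -vE; apply: (mulIf (lt0r_neq0 v0)).
  rewrite divfK ?gt_eqF//; lra.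
rewrite /black_scholes gt_eqF// /bs_d2 d1E -vE /normalized_call kE.
rewrite expRB expRD !lnK ?posrE// mulrBr; congr (_ - _).
by field; rewrite gt_eqF.
Qed.

Lemma implied_volatility_normalized r x0 (C : R -> R -> R) T K
    (k := ln K - r * T - ln x0) :
  0 < x0 -> 0 < T -> 0 < K -> 3 / 2 <= k -> 0 < C T K ->
  C T K < x0 * (call_const * expR (- (1 / 2))) ->
  exists y v, [/\ 1 <= y, 0 < v, v * y + v ^+ 2 / 2 = k,
    v = implied_volatility r x0 C T K * Num.sqrt T &
    C T K = x0 * normalized_call y v].
Proof.
move=> x00 T0 K0 k32 C0 Clt.
have sT0 : 0 < Num.sqrt T by rewrite sqrtr_gt0.
set s := implied_volatility r x0 C T K.
have [s0 sE] : 0 <= s /\ black_scholes r x0 T K s = C T K.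
  apply: (@getPex _ [set sigma : R | 0 <= sigma /\
    black_scholes r x0 T K sigma = C T K]).
  (* [get] returns an element of its set only if there is one; v / sqrt T is a witness. *)
  have [||y [v [v0 vk vc]]] := @normalized_call_surj R k (C T K / x0) k32.
  - by rewrite divr_gt0.
  - by rewrite ler_pdivrMr// mulrC ltW.
  exists (v / Num.sqrt T); split; first by rewrite divr_ge0// ltW.
  rewrite (@black_scholes_normalized _ _ _ _ _ y v)// ?divr_gt0//.
    by rewrite vc mulrC divfK// gt_eqF.
  by rewrite divfK// gt_eqF.
(* At sigma = 0 the Black-Scholes price vanishes because k > 0, against C > 0. *)
have {}s0 : 0 < s.
  rewrite lt_neqAle s0 andbT eq_sym; apply/eqP => s_eq0; move: sE.
  rewrite /black_scholes s_eq0 eqxx => CE; move: C0; rewrite -CE.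
  rewrite lt_max ltxx orbF ltNge => /negP; apply.
  rewrite subr_le0 -[leLHS]lnK ?posrE// -[K in leRHS]lnK ?posrE//.
  rewrite -expRD ler_expR.
  by move: k32; rewrite /k; lra.
pose v := s * Num.sqrt T.
have v0 : 0 < v by rewrite mulr_gt0.
pose y := (k - v ^+ 2 / 2) / v.
have vk : v * y + v ^+ 2 / 2 = k by rewrite /y mulrC divfK ?gt_eqF// subrK.
have CE : C T K = x0 * normalized_call y v.
  by rewrite -sE; exact: black_scholes_normalized.
exists y, v; split => //.
(* If y < 1, the price would reach the threshold assumed to lie above it. *)
rewrite leNgt; apply/negP => y1; move: Clt; rewrite CE ltr_pM2l// ltNge.
by rewrite normalized_call_ge_lt1// vk.
Qed.

(** Logarithms of the two price bounds: [A] absorbs ln x0 and the logarithm of [call_const], and 3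
    ln y comes from y^-3. *)
Lemma log_call_bounds x0 y v c (A := `|ln x0| + `|ln call_const|) :
  0 < x0 -> 1 <= y -> 0 < v -> 3 / 2 <= v * y + v ^+ 2 / 2 ->
  0 < c -> c = x0 * normalized_call y v ->
  y ^+ 2 / 2 <= ln (1 / c) + A /\ ln (1 / c) <= A + 3 * ln y + y ^+ 2 / 2.
Proof.
move=> x00 y1 v0 hk c0 cE.
have y0 : 0 < y by lra.
have k0 := @call_const_gt0 R.
have -> : ln (1 / c) = - ln c by rewrite mul1r lnV ?posrE.
have := ler_norm (ln x0); have := ler_norm (- ln x0).
have := ler_norm (ln call_const : R); have := ler_norm (- ln call_const : R).
rewrite !normrN /A.
have : ln c <= ln x0 + (- y ^+ 2 / 2).
  rewrite -[- y ^+ 2 / 2]expRK -lnM ?posrE ?expR_gt0//.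
  rewrite ler_ln ?posrE ?mulr_gt0 ?expR_gt0// cE ler_pM2l//.
  exact: normalized_call_le.
pose b : R := call_const / y ^+ 3.
have y30 : 0 < y ^+ 3 by rewrite exprn_gt0.
have b0 : 0 < b by rewrite divr_gt0.
have be0 : 0 < b * expR (- y ^+ 2 / 2) by rewrite mulr_gt0 ?expR_gt0.
have lnb : ln b = ln call_const - 3 * ln y.
  by rewrite ln_div ?posrE// lnXn// mulr_natl.
have : ln x0 + (ln b + (- y ^+ 2 / 2)) <= ln c.
  rewrite -[- y ^+ 2 / 2]expRK -!lnM ?posrE ?expR_gt0//.
  rewrite ler_ln ?posrE ?(mulr_gt0 x00)// cE ler_pM2l//.
  exact: normalized_call_ge_ge1.
rewrite lnb.
by move=> ? ? ? ? ? ?; split; lra.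
Qed.

(** Since v + y = sqrt (y^2 + 2 k), the error splits into v + y against sqrt (2 (m + L)) and y
    against sqrt (2 L). Each part is a difference of squares of order ln L over a sum that is at
    least sqrt L. *)
Lemma sqrt_diff_bound (L m y v A a : R) (k := v * y + v ^+ 2 / 2) :
  1 <= y -> 0 < v -> 0 <= A -> 0 <= m -> expR 1 <= L -> 2 + 2 * A <= L ->
  y ^+ 2 / 2 <= L + A -> L <= A + 3 * ln y + y ^+ 2 / 2 ->
  `|k - m| <= a ->
  `|v - Num.sqrt 2 * (Num.sqrt (m + L) - Num.sqrt L)| <=
    (4 * A + 2 * a + 12) * (ln L / Num.sqrt L).
Proof.
move=> y1 v0 A0 m0 eL AL up lo km.
have L1 : 2 <= L by lra.
have L0 : 0 < L by lra.
have lnL : 1 <= ln L by rewrite -[leLHS]expRK ler_ln ?posrE ?expR_gt0.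
(* From y^2 <= 2 L + 2 A <= L^2; this lets ln L replace ln y. *)
have yL : y <= L.
  rewrite -(@ler_pXn2r _ 2)// ?nnegrE; [|lra|lra].
  have : 2 * L <= (L - 2 * A) * L by rewrite ler_wpM2r; lra.
  have : 2 * A * 1 <= 2 * A * L by rewrite ler_wpM2l; lra.
  rewrite [L ^+ 2]expr2; lra.
have lny : ln y <= ln L by rewrite ler_ln ?posrE; lra.
pose Y := Num.sqrt 2 * Num.sqrt L.
pose W := Num.sqrt 2 * Num.sqrt (m + L).
have sL0 : 0 < Num.sqrt L by rewrite sqrtr_gt0.
have s21 : 1 <= Num.sqrt 2 :> R by rewrite -[leLHS]sqrtr1 ler_wsqrtr// ler1n.
have sLY : Num.sqrt L <= Y by rewrite ler_peMl// ltW.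
have sLW : Num.sqrt L <= W.
  rewrite (le_trans sLY)// ler_wpM2l ?sqrtr_ge0// ler_wsqrtr//; lra.
have Y2 : Y ^+ 2 = 2 * L by rewrite exprMn !sqr_sqrtr// ltW.
have W2 : W ^+ 2 = 2 * (m + L) by rewrite exprMn !sqr_sqrtr//; lra.
pose D := y ^+ 2 - Y ^+ 2.
have DL : `|D| <= 2 * A + 6 * ln L by rewrite ler_norml /D Y2; lra.
have divb p q e : 0 < q -> `|p ^+ 2 - q ^+ 2| <= e -> 0 <= p ->
    Num.sqrt L <= q -> `|p - q| <= e / Num.sqrt L.
  move=> q0 pqe p0 Lq; rewrite ler_pdivlMr//; apply: le_trans pqe.
  rewrite subr_sqr normrM ler_wpM2l//.
  by rewrite (le_trans _ (ler_norm _))// ler_wpDl.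
have dy : `|y - Y| <= (2 * A + 6 * ln L) / Num.sqrt L.
  by apply: divb => //; lra.
have dS : `|(v + y) - W| <= (2 * A + 6 * ln L + 2 * a) / Num.sqrt L.
  apply: divb => //; [lra| |lra].
  have -> : (v + y) ^+ 2 - W ^+ 2 = D + 2 * (k - m).
    by rewrite /D /k W2 Y2; field.
  rewrite (le_trans (ler_normD _ _))// lerD// normrM ger0_norm// ler_wpM2l//.
have -> : v - Num.sqrt 2 * (Num.sqrt (m + L) - Num.sqrt L) =
    (v + y - W) - (y - Y) by rewrite /W /Y; ring.
apply: (le_trans (ler_normB _ _)).
apply: (le_trans (lerD dS dy)).
rewrite -mulrDl mulrA ler_wpM2r ?invr_ge0 ?sqrtr_ge0//.
have a0 : 0 <= a by apply: le_trans km.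
(* As ln L >= 1, the constants of the two numerators are absorbed into ln L. *)
have : (4 * A + 2 * a) * 1 <= (4 * A + 2 * a) * ln L by rewrite ler_wpM2l; lra.
lra.
Qed.

End implied_volatility_asymptotics.

(** * Thresholds on the strike, and the return from v to I *)

Theorem corollary2p2 (R : realType) (r x0 : R) (C : R -> R -> R) (T : R) :
  0 <= r -> 0 < x0 -> is_call_pricing_function r x0 C -> 0 < T ->
  eq_bigO_pinfty
    (fun K => implied_volatility r x0 C T K)
    (fun K => Num.sqrt 2 / Num.sqrt T *
       (Num.sqrt (ln K + ln (1 / C T K)) - Num.sqrt (ln (1 / C T K))))
    (fun K => ln (1 / C T K) `^ (- (1 / 2)) * ln (ln (1 / C T K))).
Proof.
move=> _ x00 hC T0.
have sT0 : 0 < Num.sqrt T by rewrite sqrtr_gt0.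
pose A : R := `|ln x0| + `|ln call_const|.
(* This is |k - ln K|, which does not depend on K. *)
pose a := `|- (r * T) - ln x0|.
pose alpha := 4 * A + 2 * a + 12.
have A0 : 0 <= A by rewrite addr_ge0.
have a0 : 0 <= a by exact: normr_ge0.
exists (alpha / Num.sqrt T).
  by rewrite divr_gt0// /alpha; lra.
(* C < e^(-M) gives both lower bounds on L that [sqrt_diff_bound] requires. *)
pose M := Num.max (expR 1) (2 + 2 * A).
have Csmall e : 0 < e -> \forall K \near +oo, C T K < e.
  by move=> e0; move: (cvg_call_pricing hC T0) => /cvgr_lt; apply.
near=> K.
have K0 : 0 <= K by near: K; apply: nbhs_pinfty_ge; rewrite num_real.
(* The absolute value yields ln K >= 0 together with k >= 3/2. *)
have K1 : expR (`|3 / 2 + r * T + ln x0|) <= K.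
  by near: K; apply: nbhs_pinfty_ge; rewrite num_real.
have {}K0 : 0 < K by apply: lt_le_trans K1; exact: expR_gt0.
have lnK1 : `|3 / 2 + r * T + ln x0| <= ln K.
  by rewrite -[leLHS]expRK ler_ln ?posrE ?expR_gt0.
have k32 : 3 / 2 <= ln K - r * T - ln x0.
  by have := le_trans (ler_norm _) lnK1; lra.
have C0 : 0 < C T K by apply: (call_pricing_gt0 hC T0); exact: ltW.
have C1 : C T K < x0 * (call_const * expR (- (1 / 2))).
  near: K; apply: Csmall.
  by rewrite mulr_gt0// (mulr_gt0 (@call_const_gt0 R)) ?expR_gt0.
have C2 : C T K < expR (- M) by near: K; apply: Csmall; exact: expR_gt0.
have [y [v [y1 v0 vk vE CE]]] :=
  implied_volatility_normalized x00 T0 K0 k32 C0 C1.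
rewrite -vk in k32.
have [up lo] := log_call_bounds x00 y1 v0 k32 C0 CE.
set L := ln (1 / C T K) in up lo *.
have ML : M <= L.
  rewrite /L mul1r lnV ?posrE// lerNr -[leRHS]expRK ler_ln ?posrE ?expR_gt0//.
  exact: ltW.
have [eL AL] : expR 1 <= L /\ 2 + 2 * A <= L.
  by move: ML; rewrite ge_max => /andP.
have lnK0 : 0 <= ln K by apply: le_trans lnK1.
have L0 : 0 < L by apply: lt_le_trans eL; exact: expR_gt0.
have km : `|v * y + v ^+ 2 / 2 - ln K| <= a.
  by rewrite vk /a le_eqVlt; apply/orP; left; apply/eqP; congr `|_|; ring.
have := sqrt_diff_bound y1 v0 A0 lnK0 eL AL up lo km.
have -> : L `^ (- (1 / 2)) * ln L = ln L / Num.sqrt L.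
  by rewrite powRN mul1r powR12_sqrt ?(ltW L0)// mulrC.
(* Division by sqrt T turns the bound on v = I sqrt T into one on I. *)
rewrite -(ler_pM2r (_ : 0 < (Num.sqrt T)^-1)) ?invr_gt0//.
rewrite -{1}(@ger0_norm _ (Num.sqrt T)^-1) ?invr_ge0 ?sqrtr_ge0// -normrM.
have -> : (v - Num.sqrt 2 * (Num.sqrt (ln K + L) - Num.sqrt L)) / Num.sqrt T =
  implied_volatility r x0 C T K -
    Num.sqrt 2 / Num.sqrt T * (Num.sqrt (ln K + L) - Num.sqrt L).
  by rewrite vE; field; rewrite gt_eqF.
by rewrite [alpha / _ * _]mulrAC.
Unshelve. all: by end_near. Qed.
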